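(* Let $S$ and $T$ be quasi-countable inverse semigroups equipped with standard metrics. Suppose there is a semigroup homomorphism $\varphi \colon S \to T$ and a constant $k$ such that $\varphi$ is at most $k$-to-one on each $\mathcal{R}$-class of $S$. If $T$ has Property A, then $S$ has Property A.
   Context: An inverse semigroup is a semigroup $S$ in which every $s$ has a unique $s^{-1}$ with $ss^{-1}s=s$ and $s^{-1}ss^{-1}=s^{-1}$. $E(S)$ is its set of idempotents. Two elements $s,t$ are $\mathcal{R}$-related iff $ss^{-1}=tt^{-1}$ (equivalently $sS=tS$). $S$ is quasi-countable if there is a countable set $X$ of elements such that $S$ is generated, under multiplication and inversion, by $X\cup E(S)$. An extended metric is a function $d\colon X\times X\to[0,\infty]$ satisfying the usual metric axioms; its components are the classes of the relation $d(x,y)<\infty$; $B(x,r)$ is the ball of radius $r$ around $x$. An extended metric space is uniformly discrete if there is a positive lower bound on the distance between distinct points, and has bounded geometry if for each $r>0$ there is a finite upper bound on the cardinality of balls of radius $r$. A standard metric on a quasi-countable inverse semigroup $S$ is a uniformly discrete extended metric $d$ whose components are exactly the $\mathcal{R}$-classes of $S$, which is left subinvariant ($d(xs,xt)\le d(s,t)$ for all $s,t,x\in S$) and proper (for every $r\ge 0$ there is a finite $F\subseteq S$ such that $y\in xF$ for every pair $x\ne y$ in $S$ with $d(x,y)\le r$). Every quasi-countable inverse semigroup has a standard metric, unique up to coarse equivalence. Property A: a uniformly discrete extended metric space $(X,d)$ with bounded geometry has Property A if for every $\epsilon>0$ and $R>0$ there exist a number $L>0$ and a map $x\mapsto \xi_x$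 from $X$ to the set of non-negative functions on $X$ of $\ell_1$-norm $1$ such that (1) $\|\xi_x-\xi_y\|_1\le\epsilon$ whenever $d(x,y)\le R$, and (2) the support of $\xi_x$ is contained in $B(x,L)$ for all $x\in X$. Property A for $S$ or $T$ means Property A of the space given by the standard metric (it is invariant under coarse equivalence, so does not depend on the choice of standard metric). *)

(* Defs.v *)
From HB Require Import structures.
From mathcomp Require Import all_boot all_order all_algebra.
From mathcomp Require Import all_classical all_reals all_analysis.

Set Implicit Arguments.
Unset Strict Implicit.
Unset Printing Implicit Defensive.

Import Order.TTheory GRing.Theory Num.Theory.

Local Open Scope classical_set_scope.
Local Open Scope ring_scope.

(* [sinvP] says both that [sinv s] is an inverse of [s] and that it is the only
   one. The notation [_^-1] is not available here: it belongs to the library's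
   [baseGroupType], which has a unit element. *)
HB.mixin Record Semigroup_isInverse S of Semigroup S := {
  sinv : S -> S;
  sinvP : forall s t : S,
    t = sinv s <-> (s * t * s = s)%g /\ (t * s * t = t)%g
}.

#[short(type="inverseSemigroupType")]
HB.structure Definition InverseSemigroup :=
  {S of Semigroup_isInverse S & Semigroup S}.

Section InverseSemigroups.
Variable S : inverseSemigroupType.

Definition idempotents : set S := [set e | (e * e)%g = e].

Definition green_R (s t : S) : Prop := (s * sinv s = t * sinv t)%g.

Definition inverse_subsemigroup (A : set S) : Prop :=
  (forall s t, A s -> A t -> A (s * t)%g) /\ (forall s, A s -> A (sinv s)).

Definition inv_generated (X : set S) : set S := smallest inverse_subsemigroup X.

Definition quasi_countable : Prop :=
  exists2 X : set S, countable X & inv_generated (X `|` idempotents) = setT.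

End InverseSemigroups.

Section ExtendedMetrics.
Variables (R : realType) (X : Type).
Implicit Types d : X -> X -> \bar R.

Definition extended_metric d : Prop :=
  [/\ forall x y, (0 <= d x y)%E,
      forall x y, d x y = 0%E <-> x = y,
      forall x y, d x y = d y x &
      forall x y z, (d x z <= d x y + d y z)%E].

Definition eball d (x : X) (r : R) : set X := [set y | (d x y <= r%:E)%E].

Definition uniformly_discrete d : Prop :=
  exists2 c : R, 0 < c & forall x y, x <> y -> (c%:E <= d x y)%E.

Definition bounded_geometry d : Prop :=
  forall r : R, 0 < r -> exists n : nat, forall x, (eball d x r #<= `I_n)%card.

End ExtendedMetrics.

Section StandardMetrics.
Variables (R : realType) (S : inverseSemigroupType) (d : S -> S -> \bar R).

Definition left_subinvariant : Prop :=
  forall s t x : S, (d (x * s)%g (x * t)%g <= d s t)%E.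

Definition proper_metric : Prop :=
  forall r : R, 0 <= r -> exists2 F : set S, finite_set F &
    forall x y : S, x <> y -> (d x y <= r%:E)%E ->
      exists2 f, F f & y = (x * f)%g.

Definition standard_metric : Prop :=
  [/\ extended_metric d,
      uniformly_discrete d,
      forall s t, (d s t < +oo)%E <-> green_R s t,
      left_subinvariant &
      proper_metric].

End StandardMetrics.

Section PropertyA.
Variables (R : realType) (X : choiceType).

Definition l1norm (f : X -> R) : \bar R := (\esum_(z in setT) `|f z|%:E)%E.

(* The first three conjuncts are the class of spaces on which Property A is
   defined. *)
Definition property_A (d : X -> X -> \bar R) : Prop :=
  [/\ extended_metric d, uniformly_discrete d, bounded_geometry d &
  forall eps r : R, 0 < eps -> 0 < r ->
    exists (L : R) (xi : X -> X -> R),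
    [/\ 0 < L,
        forall x z, 0 <= xi x z,
        forall x, l1norm (xi x) = 1%E,
        forall x y, (d x y <= r%:E)%E ->
          (l1norm (fun z => (xi x z - xi y z)%R) <= eps%:E)%E &
        forall x z, xi x z != 0 -> eball d x L z]].

End PropertyA.

Definition at_most_to_one_on_R_classes (S T : inverseSemigroupType)
    (k : nat) (phi : S -> T) : Prop :=
  forall (s : S) (t : T), ([set x | green_R s x /\ phi x = t] #<= `I_k)%card.

(* Main.v *)
(* The map phi is bornologous, since phi (s f) lies within
   dT (phi (f f^-1), phi f) of phi s whenever s f is R-related to s. It need not
   be a coarse embedding, but the preimage A_y of a ball B(y, L) meets each
   R-class in at most k |B(y, L)| points, so for fixed r every r-chain component
   of A_y has uniformly bounded diameter. Let q s y be a chosen point of the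
   r-chain component of s in A_y, and let zeta_s be the image under q s of the
   Property A function xi_(phi s). If d(s, s') <= r and y is in the support of
   both xi_(phi s) and xi_(phi s'), then s and s' lie in the same component of
   A_y and q s y = q s' y; hence
   |zeta_s - zeta_s'| <= |xi_(phi s) - xi_(phi s')| in l1. *)

Require Import Defs.
From mathcomp Require Import all_boot all_order all_algebra.
From mathcomp Require Import all_classical all_reals all_analysis.

Set Implicit Arguments.
Unset Strict Implicit.
Unset Printing Implicit Defensive.

Import Order.TTheory GRing.Theory Num.Theory.

Local Open Scope classical_set_scope.
Local Open Scope ring_scope.

Section InverseSemigroupTheory.
Variable S : inverseSemigroupType.
Implicit Types s t e f : S.
Local Open Scope group_scope.

Lemma mulsVs s : s * sinv s * s = s.
Proof. by case: (proj1 (sinvP s (sinv s)) erefl). Qed.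

Lemma mulVsV s : sinv s * s * sinv s = sinv s.
Proof. by case: (proj1 (sinvP s (sinv s)) erefl). Qed.

Lemma sinv_unique s t : s * t * s = s -> t * s * t = t -> t = sinv s.
Proof. by move=> st ts; apply/sinvP. Qed.

Lemma sinvK : involutive (@sinv S).
Proof. by move=> s; apply/esym/sinv_unique; [exact: mulVsV|exact: mulsVs]. Qed.

Lemma sinv_idempotent e : idempotents e -> sinv e = e.
Proof. by move=> ee; apply/esym/sinv_unique; rewrite ee ee. Qed.

Lemma idempotent_mulsV s : idempotents (s * sinv s).
Proof. by rewrite /idempotents/= mulgA mulsVs. Qed.

Lemma idempotent_mulVs s : idempotents (sinv s * s).
Proof. by rewrite /idempotents/= mulgA mulVsV. Qed.

Lemma idempotent_mul e f :
  idempotents e -> idempotents f -> idempotents (e * f).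
Proof.
rewrite /idempotents/= => ee ff.
have x_def : f * sinv (e * f) * e = sinv (e * f).
  apply: sinv_unique.
    by rewrite !mulgA -(mulgA e f f) ff -(mulgA _ e e) ee -!mulgA
      (mulgA e f) mulgA mulsVs.
  rewrite !mulgA -(mulgA _ e e) ee -(mulgA _ f f) ff.
  by rewrite -!mulgA (mulgA e f) (mulgA (sinv _)) (mulgA _ (sinv _) e) mulVsV.
have xx : idempotents (sinv (e * f)).
  rewrite /idempotents/= -x_def.
  rewrite !mulgA -(mulgA (f * _ * e)) -!mulgA (mulgA e f) (mulgA (sinv _)).
  by rewrite (mulgA _ (sinv _) e) mulVsV.
by rewrite -(sinvK (e * f)) (sinv_idempotent xx).
Qed.

Lemma idempotentC e f :
  idempotents e -> idempotents f -> e * f = f * e.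
Proof.
move=> ee ff.
have efi := idempotent_mul ee ff; have fei := idempotent_mul ff ee.
rewrite -[LHS](sinv_idempotent efi); apply/esym/sinv_unique.
  rewrite !mulgA -(mulgA e f f) ff -(mulgA _ e e) ee.
  by rewrite -mulgA; exact: efi.
rewrite !mulgA -(mulgA f e e) ee -(mulgA _ f f) ff.
by rewrite -mulgA; exact: fei.
Qed.

Lemma green_R_idempotent s : green_R (s * sinv s) s.
Proof.
by rewrite /green_R (sinv_idempotent (idempotent_mulsV s)) idempotent_mulsV.
Qed.

(* From [s * sinv s = s * f * w] one gets [h = h * f * w] for [h = sinv s * s],
   and [f * sinv f] is a left identity of [f] commuting with [h]. *)
Lemma green_R_mul s f : green_R s (s * f) -> s * (f * sinv f) = s.
Proof.
rewrite /green_R => R_s; set h := sinv s * s; set w := sinv (s * f) * s.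
have hfw : h * f * w = h.
  rewrite /h /w -!mulgA (mulgA s f) (mulgA (s * f)) -R_s.
  by rewrite mulsVs.
have hi : idempotents h by exact: idempotent_mulVs.
have ffi := idempotent_mulsV f.
have hff : h * (f * sinv f) = h.
  have c : f * sinv f * (h * f) = h * f.
    by rewrite mulgA (idempotentC ffi hi) -mulgA mulsVs.
  by rewrite (idempotentC hi ffi) -hfw (mulgA (f * sinv f)) c.
by rewrite -{1}(mulsVs s) -(mulgA s) -/h -mulgA hff /h mulgA mulsVs.
Qed.

End InverseSemigroupTheory.

Lemma sinv_morph (S T : inverseSemigroupType) (phi : {multiplicative S -> T}) :
  {morph phi : s / sinv s >-> sinv s}.
Proof.
by move=> s; apply: sinv_unique; rewrite -!gmulfM ?mulsVs ?mulVsV.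
Qed.

Lemma green_R_morph (S T : inverseSemigroupType)
    (phi : {multiplicative S -> T}) (s t : S) :
  green_R s t -> green_R (phi s) (phi t).
Proof. by rewrite /green_R -!sinv_morph -!gmulfM => ->. Qed.

Section Counting.
Local Open Scope card_scope.

Lemma uniq_size_card (X : choiceType) (A : set X) (n : nat) (p : seq X) :
  A #<= `I_n -> uniq p -> [set` p] `<=` A -> (size p <= n)%N.
Proof.
move=> An up pA; have fA : finite_set A by apply/finite_set_leP; exists n.
apply: leq_trans (geq_card_fset_set An).
by apply: uniq_leq_size => // x /pA Ax; rewrite in_fset_set// inE.
Qed.

Lemma size_le_fibers (X Y : eqType) (f : X -> Y) (k : nat) (ts : seq Y)
    (p : seq X) :
  (forall x, x \in p -> f x \in ts) ->
  (forall t, (count (fun x => f x == t) p <= k)%N) ->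
  (size p <= k * size ts)%N.
Proof.
elim: ts p => [|t ts IH] p pts fib.
  by case: p pts {fib} => // x p /(_ x); rewrite mem_head => /(_ isT).
rewrite /= mulnS -(count_predC (fun x => f x == t)) leq_add//.
rewrite -size_filter IH// => [x|u].
  by rewrite mem_filter /= => /andP[ft /pts]; rewrite inE (negPf ft).
apply: leq_trans (fib u); rewrite count_filter.
by apply: sub_count => x /andP[].
Qed.

Lemma uniq_size_preimage (X Y : choiceType) (f : X -> Y) (A : set X)
    (B : set Y) (k n : nat) (p : seq X) :
  (forall t, [set x | A x /\ f x = t] #<= `I_k) -> B #<= `I_n ->
  uniq p -> (forall x, x \in p -> A x /\ B (f x)) -> (size p <= k * n)%N.
Proof.
move=> Ak Bn up pAB.
apply: (@leq_trans (k * size (undup (map f p)))).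
  apply: size_le_fibers => [x xp|t]; first by rewrite mem_undup; exact: map_f.
  rewrite -size_filter; apply: uniq_size_card (Ak t) _ _.
    exact: filter_uniq.
  by move=> x /=; rewrite mem_filter => /andP[/eqP ft /pAB[]].
rewrite leq_mul2l; apply/orP; right.
apply: uniq_size_card Bn (undup_uniq _) _ => t /=.
by rewrite mem_undup => /mapP[x /pAB[_ Bx] ->].
Qed.

End Counting.

Lemma xget_nonempty (X : choiceType) (x y : X) (P : set X) :
  P !=set0 -> xget x P = xget y P.
Proof.
move=> [z Pz]; rewrite /xget; case: pselect => // -[].
by exists z; apply/asboolP.
Qed.

Section L1.
Variable R : realType.

Lemma esum_sum_supp (X : choiceType) (f : X -> \bar R) (r : seq X) :
  uniq r -> (forall x, (0 <= f x)%E) -> (forall x, x \notin r -> f x = 0%E) ->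
  (\esum_(x in setT) f x = \sum_(x <- r) f x)%E.
Proof.
move=> ur f0 fr.
rewrite fsbig_seq// -esum_fset//.
rewrite [RHS]esum_mkcond; apply: eq_esum => x _.
case: ifPn => // /negP xr; apply: fr; apply/negP => xr'; apply: xr.
by rewrite inE.
Qed.

Lemma l1norm_seq (X : choiceType) (f : X -> R) (r : seq X) :
  uniq r -> (forall x, x \notin r -> f x = 0) ->
  l1norm f = (\sum_(x <- r) `|f x|)%:E.
Proof.
move=> ur fr; rewrite /l1norm (esum_sum_supp ur) ?sumEFin// => x.
by move=> /fr ->; rewrite normr0.
Qed.

Variables X Y : choiceType.

Definition push (q : Y -> X) (f : Y -> R) (z : X) : R :=
  \sum_(y \in [set: Y]) f y * (q y == z)%:R.

Lemma push_seq (q : Y -> X) (f : Y -> R) (r : seq Y) (z : X) :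
  uniq r -> (forall y, y \notin r -> f y = 0) ->
  push q f z = \sum_(y <- r) f y * (q y == z)%:R.
Proof.
move=> ur fr; rewrite /push (@fsbigE _ _ _ _ _ r)//.
  by apply: eq_bigl => y; rewrite in_setT.
by move=> y _ /fr ->; rewrite mul0r.
Qed.

Lemma push_ge0 (q : Y -> X) (f : Y -> R) (z : X) :
  (forall y, 0 <= f y) -> 0 <= push q f z.
Proof. by move=> f0; apply: fsumr_ge0 => y _; rewrite mulr_ge0. Qed.

Lemma push_neq0 (q : Y -> X) (f : Y -> R) (z : X) :
  push q f z != 0 -> exists2 y, f y != 0 & q y = z.
Proof.
move=> pz; apply: contrapT => no; move/eqP: pz; apply.
apply: fsbig1 => y _; have [->|fy] := eqVneq (f y) 0; first by rewrite mul0r.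
have [qy|] := eqVneq (q y) z; last by rewrite mulr0.
by exfalso; apply: no; exists y.
Qed.

Lemma esum_sum_seq (F : Y -> X -> R) (r : seq Y) :
  (forall y z, 0 <= F y z) ->
  (\esum_(z in setT) (\sum_(y <- r) F y z)%R%:E =
   \sum_(y <- r) \esum_(z in setT) (F y z)%:E)%E.
Proof.
move=> F0; rewrite -esum_sum//; last by move=> *; rewrite lee_fin.
by apply: eq_esum => z _; rewrite sumEFin.
Qed.

Lemma esum_indic (a : R) (x : X) :
  0 <= a -> (\esum_(z in setT) (a * (x == z)%:R)%R%:E = a%:E)%E.
Proof.
move=> a0; rewrite (@esum_sum_supp _ _ [:: x])//.
- by rewrite big_seq1 eqxx mulr1.
- by move=> z; rewrite lee_fin mulr_ge0.
- by move=> z; rewrite inE eq_sym => /negPf ->; rewrite mulr0.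
Qed.

Lemma l1norm_push (q : Y -> X) (f : Y -> R) :
  finite_set [set y | f y != 0] -> (forall y, 0 <= f y) ->
  l1norm (push q f) = l1norm f.
Proof.
move=> /finite_seqP[r0 fr0] f0; pose r := undup r0.
have ur : uniq r by exact: undup_uniq.
have fr y : y \notin r -> f y = 0.
  move=> yr; apply/eqP; apply: contraNT yr => fy.
  have : [set y | f y != 0] y by [].
  by rewrite fr0 /= mem_undup.
rewrite (l1norm_seq ur fr) /l1norm.
under eq_esum do
  rewrite ger0_norm ?push_ge0// (push_seq q _ ur fr).
rewrite esum_sum_seq; last by move=> *; rewrite mulr_ge0.
under eq_bigr do rewrite esum_indic//.
by rewrite sumEFin; congr EFin; apply: eq_bigr => y _; rewrite ger0_norm.
Qed.

Lemma l1norm_push_sub (q q' : Y -> X) (f g : Y -> R) :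
  finite_set [set y | f y != 0] -> finite_set [set y | g y != 0] ->
  (forall y, f y != 0 -> g y != 0 -> q y = q' y) ->
  (l1norm (fun z => (push q f z - push q' g z)%R) <=
   l1norm (fun y => (f y - g y)%R))%E.
Proof.
move=> /finite_seqP[r1 fr1] /finite_seqP[r2 gr2] qq.
pose r := undup (r1 ++ r2).
have ur : uniq r by exact: undup_uniq.
have fr y : y \notin r -> f y = 0.
  rewrite mem_undup mem_cat negb_or => /andP[yr _]; apply/eqP.
  apply: contraNT yr => fy.
  by have : [set y | f y != 0] y by []; rewrite fr1.
have gr y : y \notin r -> g y = 0.
  rewrite mem_undup mem_cat negb_or => /andP[_ yr]; apply/eqP.
  apply: contraNT yr => gy.
  by have : [set y | g y != 0] y by []; rewrite gr2.
rewrite (l1norm_seq ur); last by move=> y yr; rewrite fr// gr// subr0.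
pose F y z : R := `|f y * (q y == z)%:R - g y * (q' y == z)%:R|.
apply: (@le_trans _ _ (\esum_(z in setT) (\sum_(y <- r) F y z)%R%:E)%E).
  apply: le_esum => z _; rewrite lee_fin.
  rewrite (push_seq q _ ur fr) (push_seq q' _ ur gr) -sumrB.
  exact: ler_norm_sum.
rewrite esum_sum_seq => [|y z]; last exact: normr_ge0.
rewrite -sumEFin.
(* At each y either q y = q' y, or one of f y and g y vanishes. *)
apply: lee_sum => y _; rewrite /F.
have [f0|f0] := eqVneq (f y) 0.
  under eq_esum do rewrite f0 mul0r sub0r normrN normrM (ger0_norm (ler0n _ _)).
  by rewrite esum_indic// f0 sub0r normrN.
have [g0|g0] := eqVneq (g y) 0.
  under eq_esum do rewrite g0 mul0r subr0 normrM (ger0_norm (ler0n _ _)).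
  by rewrite esum_indic// g0 subr0.
rewrite (qq _ f0 g0).
under eq_esum do rewrite -mulrBl normrM (ger0_norm (ler0n _ _)).
by rewrite esum_indic.
Qed.

End L1.

Section Chains.
Variables (R : realType) (X : choiceType) (d : X -> X -> \bar R).
Variables (A : set X) (r : R).
Hypotheses (md : extended_metric d) (r0 : 0 <= r).

Definition chain_link : rel X := fun x y =>
  `[< [/\ A x, A y & d x y <= r%:E]%E >].

Definition chain_component (x : X) : set X :=
  [set y | exists2 p, path chain_link x p & last x p = y].

Lemma chain_component_refl x : chain_component x x.
Proof. by exists [::]. Qed.

Lemma chain_component_link x y :
  A x -> A y -> (d x y <= r%:E)%E -> chain_component x = chain_component y.
Proof.
have [_ _ dC _] := md; move=> Ax Ay dxy.
apply/seteqP; split=> z [p px <-].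
  by exists (x :: p) => //=; rewrite px andbT; apply/asboolP; rewrite dC.
by exists (y :: p) => //=; rewrite px andbT; apply/asboolP.
Qed.

Lemma chain_dist x p :
  path chain_link x p -> (d x (last x p) <= ((size p)%:R * r)%:E)%E.
Proof.
have [_ d0 _ dt] := md; elim: p x => [|y p IH] x /=.
  by rewrite mul0r => _; rewrite (proj2 (d0 x x) erefl).
move=> /andP[/asboolP[_ _ dxy] /IH dyp]; apply: le_trans (dt x y _) _.
by rewrite -natr1 mulrDl mul1r addrC EFinD leeD.
Qed.

Lemma chain_mem x p z :
  path chain_link x p -> z \in p -> A z /\ (d x z < +oo)%E.
Proof.
have [_ _ _ dt] := md; elim: p x => [//|y p IH] x /=.
move=> /andP[/asboolP[_ Ay dxy] yp]; have dxy' := le_lt_trans dxy (ltry r).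
rewrite inE => /predU1P[-> //|/(IH _ yp)[Az dyz]]; split=> //.
by apply: le_lt_trans (dt x y z) _; exact: lte_add_pinfty.
Qed.

(* A shortest chain has no repetition, hence at most [N] steps. *)
Lemma chain_component_dist (N : nat) x y :
  (forall p : seq X, uniq p ->
    (forall z, z \in p -> A z /\ (d x z < +oo)%E) -> (size p <= N)%N) ->
  chain_component x y -> (d x y <= (N%:R * r)%:E)%E.
Proof.
move=> AN [p px <-]; case/shortenP: px => q qx uq _.
apply: le_trans (chain_dist qx) _; rewrite lee_fin ler_wpM2r// ler_nat.
by apply: AN => [|z]; [case/andP: uq|exact: chain_mem].
Qed.

End Chains.

Lemma standard_metric_bounded_geometry (R : realType) (S : inverseSemigroupType)
    (d : S -> S -> \bar R) :
  standard_metric d -> bounded_geometry d.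
Proof.
move=> [_ _ _ _ dproper] r r0.
have [F /finite_seqP[s ->] dF] := dproper r (ltW r0).
exists (size s).+1 => x.
pose p := x :: [seq (x * f)%g | f <- s].
have -> : (size s).+1 = size p by rewrite /= size_map.
apply: card_le_trans (card_image_le (nth x p) `I_(size p)).
apply: subset_card_le => y dxy.
have yp : y \in p.
  have [->|/eqP yx] := eqVneq y x; first exact: mem_head.
  have [||f /= fs ->] := dF x y => //; first exact/nesym.
  by rewrite inE; apply/orP; right; exact: map_f.
by exists (index y p); [rewrite -index_mem in yp|exact: nth_index].
Qed.

Section Morphism.
Variables (R : realType) (S T : inverseSemigroupType).
Variables (dS : S -> S -> \bar R) (dT : T -> T -> \bar R).
Variable phi : {multiplicative S -> T}.
Hypotheses (stdS : standard_metric dS) (stdT : standard_metric dT).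

Lemma dist_morph_mul (s f : S) : green_R s (s * f)%g ->
  (dT (phi s) (phi (s * f)%g) <= dT (phi (f * sinv f)%g) (phi f))%E.
Proof.
have [_ _ _ dTl _] := stdT; move=> /green_R_mul sff.
by rewrite -[in phi s]sff !gmulfM; exact: dTl.
Qed.

Lemma morph_controlled (r : R) : 0 <= r ->
  exists2 M : R, 0 < M &
    forall s t, (dS s t <= r%:E)%E -> (dT (phi s) (phi t) <= M%:E)%E.
Proof.
move=> r0; have [_ _ dSR _ dSproper] := stdS.
have [[dT0 dTxx _ _] _ dTR _ _] := stdT.
have [F /finite_seqP[fs ->] dF] := dSproper r r0.
pose b f := fine (dT (phi (f * sinv f)%g) (phi f)).
have bE f : dT (phi (f * sinv f)%g) (phi f) = (b f)%:E.
  rewrite fineK// ge0_fin_numE//; apply/dTR.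
  by apply: green_R_morph; exact: green_R_idempotent.
have b0 f : 0 <= b f by exact: fine_ge0.
have M0 : 0 <= \sum_(f <- fs) b f by exact: sumr_ge0.
exists (1 + \sum_(f <- fs) b f); first by rewrite ltr_wpDr.
move=> s t dst; have [<-|/eqP st] := eqVneq s t.
  by rewrite (proj2 (dTxx _ _) erefl) lee_fin addr_ge0.
have [f /= ffs tE] := dF s t st dst.
have sRt : green_R s t by apply/dSR; exact: le_lt_trans dst (ltry r).
rewrite tE in sRt *; apply: le_trans (dist_morph_mul sRt) _.
rewrite bE lee_fin; apply: (@le_trans _ _ (\sum_(f <- fs) b f)).
  by rewrite (big_rem f)//= lerDl sumr_ge0.
by rewrite lerDr.
Qed.

End Morphism.

Theorem theorem3p4 (R : realType) (S T : inverseSemigroupType)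
    (dS : S -> S -> \bar R) (dT : T -> T -> \bar R)
    (phi : {multiplicative S -> T}) (k : nat) :
  quasi_countable S -> quasi_countable T ->
  standard_metric dS -> standard_metric dT ->
  at_most_to_one_on_R_classes k phi ->
  property_A dT -> property_A dS.
Proof.
move=> _ _ stdS stdT phik [mT _ bgT AT].
have [mS udS dSR _ _] := stdS.
split=> //; first exact: standard_metric_bounded_geometry.
move=> eps r eps0 r0.
have [M M0 phiM] := morph_controlled phi stdS stdT (ltW r0).
have [L [xi [L0 xi0 xi1 xiM xiL]]] := AT eps M eps0 M0.
have [n bn] := bgT L L0.
have [_ _ dTC _] := mT.
pose A y : set S := [set t | (dT (phi t) y <= L%:E)%E].
pose K s y := chain_component dS (A y) r s.
pose q s y := xget s (K s y).
have xi_fin x : finite_set [set y | xi x y != 0].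
  apply: (@sub_finite_set _ _ (eball dT x L)); first by move=> y; exact: xiL.
  by apply/finite_set_leP; exists n.
exists ((k * n)%:R * r + 1), (fun s => push (q s) (xi (phi s))); split.
- by rewrite ltr_wpDl// mulr_ge0// ltW.
- by move=> s z; exact: push_ge0.
- by move=> s; rewrite l1norm_push.
- move=> s s' dss; apply: le_trans (xiM _ _ (phiM _ _ dss)).
  apply: l1norm_push_sub => // y /xiL sy /xiL s'y.
  have KE : K s y = K s' y by exact: chain_component_link.
  rewrite /q KE; apply: xget_nonempty.
  by exists s'; exact: chain_component_refl.
- move=> s z /push_neq0[y _ <-].
  have Kq : K s y (q s y).
    by apply: (@xgetI _ s _ s); exact: chain_component_refl.
  apply: (@le_trans _ _ ((k * n)%:R * r)%:E); last by rewrite lee_fin lerDl.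
  apply: (chain_component_dist mS (ltW r0) _ Kq) => p up pA.
  apply: (@uniq_size_preimage _ _ phi (green_R s) (eball dT y L)) => //.
  by move=> x /pA[Ax /dSR sRx]; split=> //; rewrite /eball/= dTC.
Qed.
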